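(* Let $K$ be an algebraically closed field of characteristic zero, let $\mathcal D(X)$ be the ring of differential operators on a smooth irreducible affine algebraic curve $X$ over $K$, and let $f(t)\in K[t]$ be an arbitrary polynomial of degree $>1$. (1) Let $i\in\{1,2,5\}$. If $a\in\Delta_i(\mathcal D(X))$ then $f(a)\in\Delta_i(\mathcal D(X))$. (2) Let $i\in\{3,4\}$. If $a\in\Delta_i(\mathcal D(X))$ then $f(a)\in\Delta_5(\mathcal D(X))$.
   Context: The coordinate algebra $\mathcal O=\mathcal O(X)$ is a finitely generated regular domain of Krull dimension $1$. $\mathcal D(X)=\mathcal D(\mathcal O)=\bigcup_{i\ge0}\mathcal D(\mathcal O)_i\subseteq\operatorname{End}_K(\mathcal O)$, where $\mathcal D(\mathcal O)_0=\{u\in\operatorname{End}_K(\mathcal O):ur-ru=0\text{ for all }r\in\mathcal O\}\simeq\mathcal O$ and $\mathcal D(\mathcal O)_i=\{u\in\operatorname{End}_K(\mathcal O):ur-ru\in\mathcal D(\mathcal O)_{i-1}\text{ for all }r\in\mathcal O\}$. For a $K$-algebra $A$ with centre $Z(A)$ and $a\in A$, let $\operatorname{ad} a: b\mapsto[a,b]=ab-ba$, and (with $K$ algebraically closed) put $C(a)=\ker(\operatorname{ad} a)$; $N(a)=\bigcup_{i\ge0}\ker\big((\operatorname{ad} a)^{i+1}\big)$; $D(a)=\bigoplus_{\lambda\in K}\{b\in A:[a,b]=\lambda b\}$; $F(a)=\{b\in A:\dim_K K[\operatorname{ad} a]\,b<\infty\}$. Types of elements $a\in A\setminus Z(A)$: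 $a\in\Delta_1(A)$ (strongly nilpotent) if $N(a)=A$ and $D(a)=C(a)$; $a\in\Delta_2(A)$ (weakly nilpotent) if $C(a)\ne N(a)\ne A$ and $D(a)=C(a)$; $a\in\Delta_3(A)$ (strongly semi-simple) if $N(a)=C(a)$ and $D(a)=A$; $a\in\Delta_4(A)$ (weakly semi-simple) if $N(a)=C(a)$ and $C(a)\ne D(a)=F(a)\ne A$; $a\in\Delta_5(A)$ (generic) if $N(a)=D(a)=C(a)$. *)

(* Defs.v *)
From HB Require Import structures.
From mathcomp Require Import all_boot all_order all_algebra.
From mathcomp Require Import boolp classical_sets.

Set Implicit Arguments.
Unset Strict Implicit.
Unset Printing Implicit Defensive.

Import GRing.Theory.
Local Open Scope ring_scope.

(* MathComp has no join of idomainType and comAlgType. *)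
#[short(type="idomAlgType")]
HB.structure Definition IdomainAlgebra (K : nzRingType) :=
  {A of GRing.ComUnitAlgebra K A & GRing.IntegralDomain A}.

(* Subsets are boolean predicates below; with the excluded middle of boolp these
   are all the subsets. *)
Section CommutativeAlgebra.

Definition finitely_generated_alg (K : nzRingType) (A : algType K) : Prop :=
  exists n (x : 'I_n -> A), forall S : {pred A},
    GRing.subalg_closed S -> (forall i, x i \in S) -> forall y, y \in S.

(* A strictly increasing chain of n + 1 primes. *)
Definition prime_chain (R : comNzRingType) (n : nat) : Prop :=
  exists P : 'I_n.+1 -> prime_idealr R, forall i j : 'I_n.+1, (i < j)%N ->
    {subset P i <= P j} /\ ~ {subset P j <= P i}.

Definition krull_dim (R : comNzRingType) (n : nat) : Prop :=
  prime_chain R n /\ ~ prime_chain R n.+1.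

Definition generated_by (R : comNzRingType) (I : {pred R}) n (x : 'I_n -> R) :=
  forall y, y \in I <-> exists c : 'I_n -> R, y = \sum_i c i * x i.

(* An idealr is a proper ideal; the unit ideal is generated by 1. *)
Definition noetherian (R : comNzRingType) : Prop :=
  forall I : idealr R, exists n (x : 'I_n -> R), generated_by I x.

Definition maximal_ideal (R : comNzRingType) (M : idealr R) : Prop :=
  forall J : idealr R, {subset M <= J} -> {subset J <= M}.

Definition regular_local_ring (R : comNzRingType) : Prop :=
  noetherian R /\
  exists M : idealr R,
    [/\ maximal_ideal M,
        forall M' : idealr R, maximal_ideal M' -> M' =i M &
        exists n, krull_dim R n /\ exists x : 'I_n -> R, generated_by M x].

End CommutativeAlgebra.

(* R_P, as the subring of fractions a / s of the fraction field with s not in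
   P (R is a domain). *)
Section Localization.
Variables (R : idomainType) (P : prime_idealr R).

Definition loc_pred : {pred {fraction R}} := fun z =>
  `[< exists a s : R,
        s \notin P /\ z = FracField.tofrac a / FracField.tofrac s >].

Lemma loc_subring_closed : subring_closed loc_pred.
Proof.
have nP0 s : s \notin P -> FracField.tofrac s != 0.
  by rewrite tofrac_eq0; apply: contraNneq => ->; exact: idealr0.
have nPM s t : s \notin P -> t \notin P -> s * t \notin P.
  by move=> sP tP; rewrite prime_idealrM negb_or sP.
split.
- apply/asboolP; exists 1, 1; split; first by rewrite idealr1.
  by rewrite !tofrac1 divr1.
- move=> _ _ /asboolP[a [s [sP ->]]] /asboolP[b [t [tP ->]]]; apply/asboolP.
  exists (a * t - b * s), (s * t); split; first exact: nPM.
  rewrite tofracB !tofracM -mulNr addf_div ?nP0 //.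
  by rewrite mulNr.
- move=> _ _ /asboolP[a [s [sP ->]]] /asboolP[b [t [tP ->]]]; apply/asboolP.
  exists (a * b), (s * t); split; first exact: nPM.
  by rewrite !tofracM mulf_div.
Qed.

Record localization := Localization {
  loc_val : {fraction R};
  loc_valP : loc_pred loc_val }.

HB.instance Definition _ := [isSub for loc_val].
HB.instance Definition _ := [Choice of localization by <:].
HB.instance Definition _ := GRing.SubChoice_isSubComNzRing.Build
  {fraction R} loc_pred localization loc_subring_closed.

End Localization.

Definition regular_ring (R : idomainType) : Prop :=
  noetherian R /\ forall P : prime_idealr R, regular_local_ring (localization P).

(* End_K(O), with composition as product. MathComp gives {linear O -> O} neither
   an eqType nor an algebra structure; the former is classical. *)
Section Endomorphisms.
Variables (K : comNzRingType) (O : algType K).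

Definition endo : Type := {linear O -> O}.

HB.instance Definition _ := gen_eqMixin endo.
HB.instance Definition _ := gen_choiceMixin endo.

Implicit Types u v w : endo.

Lemma endoP u v : (forall x, u x = v x) -> u = v.
Proof.
case: u v => [u [[a1] [a2]]] [v [[b1] [b2]]] /= /funext uv.
subst v; congr (GRing.Linear.Pack (GRing.Linear.Class _ _)).
  by congr GRing.isNmodMorphism.Axioms_; exact: Prop_irrelevance.
by congr GRing.isScalable.Axioms_; exact: Prop_irrelevance.
Qed.

Definition endo0 : endo := \0.
Definition endo1 : endo := idfun.
Definition endoD u v : endo := u \+ v.
Definition endoN u : endo := \- u.
Definition endoM u v : endo := u \o v.
Definition endoZ (c : K) u : endo := c \*: u.

Lemma endoDA : associative endoD.
Proof. by move=> u v w; apply: endoP => x; exact: addrA. Qed.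
Lemma endoDC : commutative endoD.
Proof. by move=> u v; apply: endoP => x; exact: addrC. Qed.
Lemma endo0D : left_id endo0 endoD.
Proof. by move=> u; apply: endoP => x; exact: add0r. Qed.
Lemma endoND : left_inverse endo0 endoN endoD.
Proof. by move=> u; apply: endoP => x; exact: addNr. Qed.

HB.instance Definition _ := GRing.isZmodule.Build endo
  endoDA endoDC endo0D endoND.

Lemma endoMA : associative endoM.
Proof. by move=> u v w; apply: endoP. Qed.
Lemma endo1M : left_id endo1 endoM.
Proof. by move=> u; apply: endoP. Qed.
Lemma endoM1 : right_id endo1 endoM.
Proof. by move=> u; apply: endoP. Qed.
Lemma endoMDl : left_distributive endoM +%R.
Proof. by move=> u v w; apply: endoP. Qed.
Lemma endoMDr : right_distributive endoM +%R.
Proof. by move=> u v w; apply: endoP => x; exact: linearD. Qed.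
Lemma endo1_neq0 : endo1 != 0.
Proof.
apply/eqP => /(congr1 (fun u : endo => u 1)) /= e.
by have := oner_neq0 O; rewrite e eqxx.
Qed.

HB.instance Definition _ := GRing.Zmodule_isNzRing.Build endo
  endoMA endo1M endoM1 endoMDl endoMDr endo1_neq0.

Lemma endoZA c d u : endoZ c (endoZ d u) = endoZ (c * d) u.
Proof. by apply: endoP => x; exact: scalerA. Qed.
Lemma endo1Z : left_id 1 endoZ.
Proof. by move=> u; apply: endoP => x; exact: scale1r. Qed.
Lemma endoZDr : right_distributive endoZ +%R.
Proof. by move=> c u v; apply: endoP => x; exact: scalerDr. Qed.
Lemma endoZDl u : {morph endoZ^~ u : c d / c + d}.
Proof. by move=> c d; apply: endoP => x; exact: scalerDl. Qed.

HB.instance Definition _ := GRing.Zmodule_isLmodule.Build K endo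
  endoZA endo1Z endoZDr endoZDl.

Lemma endoZAl c u v : c *: (u * v) = c *: u * v.
Proof. by apply: endoP. Qed.
HB.instance Definition _ := GRing.Lmodule_isLalgebra.Build K endo endoZAl.

Lemma endoZAr c u v : c *: (u * v) = u * (c *: v).
Proof. by apply: endoP => x; exact/esym/linearZ. Qed.
HB.instance Definition _ := GRing.Lalgebra_isAlgebra.Build K endo endoZAr.

End Endomorphisms.

Section DifferentialOperators.
Variables (K : comNzRingType) (O : comAlgType K).
Implicit Types (u v : endo O) (r : O).

(* The action of O on itself, through which O embeds in End_K(O). *)
Definition mulop r : endo O := r \*o idfun.

Fixpoint diffop_ord (i : nat) : set (endo O) :=
  match i with
  | 0 => [set u | forall r, u * mulop r - mulop r * u = 0]
  | j.+1 => [set u | forall r, diffop_ord j (u * mulop r - mulop r * u)]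
  end.

Definition diffop_pred : {pred endo O} := fun u =>
  `[< (\bigcup_i diffop_ord i)%classic u >].

Lemma diffop_ord_linear i (c : K) u v :
  diffop_ord i u -> diffop_ord i v -> diffop_ord i (c *: u + v).
Proof.
elim: i u v => [|i IHi] u v Du Dv r.
  rewrite mulrDl mulrDr opprD addrACA Dv -scalerAl -scalerAr -scalerBr Du.
  by rewrite scaler0 addr0.
rewrite mulrDl mulrDr opprD addrACA -scalerAl -scalerAr -scalerBr.
exact: IHi.
Qed.

Lemma diffop_ord0 i : diffop_ord i 0.
Proof. by elim: i => [|i IHi] r; rewrite mul0r mulr0 subrr. Qed.

Lemma diffop_ordD i u v :
  diffop_ord i u -> diffop_ord i v -> diffop_ord i (u + v).
Proof. by rewrite -[u in u + v]scale1r; exact: diffop_ord_linear. Qed.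

Lemma diffop_ordS i u : diffop_ord i u -> diffop_ord i.+1 u.
Proof.
elim: i u => [|i IHi] u Du r; last exact/IHi/Du.
by rewrite Du; exact: (@diffop_ord0 0).
Qed.

Lemma diffop_ord_le i j u : (i <= j)%N -> diffop_ord i u -> diffop_ord j u.
Proof.
move/subnKC <-; elim: (j - i)%N u => [|k IHk] u; rewrite ?addn0 // addnS.
by move=> /IHk/diffop_ordS.
Qed.

Lemma diffop_ordM i j u v :
  diffop_ord i u -> diffop_ord j v -> diffop_ord (i + j) (u * v).
Proof.
have commM w w' r : (w * w') * mulop r - mulop r * (w * w') =
    w * (w' * mulop r - mulop r * w') + (w * mulop r - mulop r * w) * w'.
  by rewrite mulrBr mulrBl !mulrA addrA subrK.
have [n] := ubnP (i + j); elim: n i j u v => // n IHn i j u v lijn Du Dv.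
have Dl r : diffop_ord (i + j).-1 (u * (v * mulop r - mulop r * v)).
  case: j lijn Dv => [|j] lijn Dv.
    by rewrite Dv mulr0; exact: diffop_ord0.
  by rewrite addnS /=; apply: IHn => //; rewrite -ltnS -addnS.
have Dr r : diffop_ord (i + j).-1 ((u * mulop r - mulop r * u) * v).
  case: i lijn Du {Dl} => [|i] lijn Du.
    by rewrite Du mul0r; exact: diffop_ord0.
  by rewrite addSn /=; apply: IHn => //; rewrite -ltnS -addSn.
case: i j lijn Du Dv Dl Dr => [|i] [|j] lijn Du Dv Dl Dr r /=; last 3 first.
- by rewrite commM; exact: diffop_ordD.
- by rewrite commM; exact: diffop_ordD.
- by rewrite commM; exact: diffop_ordD.
by rewrite commM Du Dv mulr0 mul0r addr0.
Qed.

Lemma diffop_subalg_closed : GRing.subsemialg_closed diffop_pred.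
Proof.
apply: GRing.subalg_closed_semi; split.
- apply/asboolP; exists 0%N => // r.
  by rewrite mul1r mulr1 subrr.
- move=> c u v /asboolP[i _ Du] /asboolP[j _ Dv]; apply/asboolP.
  exists (maxn i j) => //; apply: diffop_ord_linear.
  + exact: diffop_ord_le (leq_maxl i j) Du.
  + exact: diffop_ord_le (leq_maxr i j) Dv.
- move=> u v /asboolP[i _ Du] /asboolP[j _ Dv]; apply/asboolP.
  by exists (i + j)%N => //; exact: diffop_ordM.
Qed.

Record diffop := Diffop {
  diffop_val : endo O;
  diffop_valP : diffop_pred diffop_val }.

HB.instance Definition _ := [isSub for diffop_val].
HB.instance Definition _ := [Choice of diffop by <:].
HB.instance Definition _ := GRing.SubChoice_isSubAlgebra.Build
  K (endo O) diffop_pred diffop diffop_subalg_closed.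

End DifferentialOperators.

Section Types.
Variables (K : fieldType) (A : algType K).
Implicit Types a b : A.
Local Open Scope classical_set_scope.

Definition ad a b : A := a * b - b * a.

Definition center : set A := [set a | forall b, a * b = b * a].

Definition adC a : set A := [set b | ad a b = 0].

Definition adN a : set A := \bigcup_i [set b | iter i.+1 (ad a) b = 0].

(* The sum of the eigenspaces of ad a, which is automatically direct. *)
Definition adD a : set A := [set b | exists n (l : 'I_n -> K) (v : 'I_n -> A),
  (forall i, ad a (v i) = l i *: v i) /\ b = \sum_i v i].

(* p(ad a) b *)
Definition ad_poly a (p : {poly K}) b : A :=
  \sum_(i < size p) p`_i *: iter i (ad a) b.

(* For a linear subspace V, this is dim_K V < oo. *)
Definition finite_dim (V : set A) : Prop :=
  exists n (v : 'I_n -> A), (forall i, V (v i)) /\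
    forall y, V y -> exists c : 'I_n -> K, y = \sum_i c i *: v i.

Definition adF a : set A := [set b | finite_dim (range (ad_poly a ^~ b))].

Definition strongly_nilpotent a := adN a = setT /\ adD a = adC a.
Definition weakly_nilpotent a :=
  [/\ adC a <> adN a, adN a <> setT & adD a = adC a].
Definition strongly_semisimple a := adN a = adC a /\ adD a = setT.
Definition weakly_semisimple a :=
  [/\ adN a = adC a, adC a <> adD a, adD a = adF a & adF a <> setT].
Definition generic a := adN a = adD a /\ adD a = adC a.

(* Delta_i for 1 <= i <= 5; the other indices are junk. *)
Definition Delta (i : nat) : set A := [set a | ~ center a /\
  match i with
  | 1 => strongly_nilpotent a
  | 2 => weakly_nilpotent a
  | 3 => strongly_semisimple a
  | 4 => weakly_semisimple a
  | 5 => generic a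
  | _ => False
  end].

End Types.

(* Main.v *)
Require Import Defs.
From mathcomp Require Import all_boot all_order all_algebra.
From mathcomp Require Import boolp classical_sets.

Set Implicit Arguments.
Unset Strict Implicit.
Unset Printing Implicit Defensive.

Import GRing.Theory.
Local Open Scope ring_scope.

(** The theorem is about leading terms in the order filtration of D = D(O).
    An operator u of order at most n has a principal symbol, the function
    r |-> ad(r)^n(u) / n! from O to O ([sym], with bracketing on the right,
    which absorbs the sign). It is polynomial along lines, vanishes exactly when
    u has order less than n ([diffop_ord_pred]), and is multiplicative ([symM]).
    So the graded ring of D is a commutative domain of characteristic 0, since O
    is a domain over a field of characteristic 0.

    Let d > 1 be the degree of f and suppose that a has order m > 0. In
    [a^d, x] = sum_i a^i [a, x] a^(d-1-i) all summands have the same symbol, and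
    the lower powers of a contribute lower orders, whence the key inequality
      ord [f(a), x] >= (d - 1) m + ord [a, x]     whenever [a, x] <> 0
    ([ad_horner_order]); in particular [f(a), x] has larger order than [a, x].
    Two consequences follow.
    - [f(a), x] = 0 only if [a, x] = 0, so C(f(a)) = C(a), and then also
      N(f(a)) = N(a), as ad a and ad f(a) commute.
    - f(a) has no nonzero eigenvalue. If [f(a), x] = l x with l and x nonzero,
      then [a, x] is again a nonzero eigenvector for l, and by the key
      inequality its order is smaller than that of x; this cannot go on
      forever ([horner_no_eigenvector]). So D(f(a)) = C(f(a)).

    If a has order 0, it is multiplication by a function, and so is f(a). Such
    operators act ad-nilpotently, so N(a) and N(f(a)) are everything, whence
    D(a) = C(a) and D(f(a)) = C(f(a)). What is left is that f(a) is not
    central. As N(a) = D and a is not central, some x has [a, x] <> 0 and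
    [a, [a, x]] = 0; then [f(a), x] = f'(a) [a, x], which cannot vanish since a
    is transcendental over K ([ad_horner_nilpotent_size]).

    The five types are read off these equalities; a noncentral a with
    N(a) = C(a) cannot have order 0. *)

(** * The inner derivations of an algebra *)

Section InnerDerivations.
Variables (K : fieldType) (A : algType K).
Implicit Types (a b x y : A) (p : {poly K}).

Lemma adDl a b x : ad (a + b) x = ad a x + ad b x.
Proof. by rewrite /ad mulrDl mulrDr opprD addrACA. Qed.

Lemma adZl (c : K) a x : ad (c *: a) x = c *: ad a x.
Proof. by rewrite /ad -scalerAl -scalerAr scalerBr. Qed.

Lemma adDr a x y : ad a (x + y) = ad a x + ad a y.
Proof. by rewrite /ad mulrDl mulrDr opprD addrACA. Qed.

Lemma adZr a (c : K) x : ad a (c *: x) = c *: ad a x.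
Proof. by rewrite /ad -scalerAr -scalerAl scalerBr. Qed.

Lemma ad_suml n (F : 'I_n -> A) x : ad (\sum_i F i) x = \sum_i ad (F i) x.
Proof. by rewrite /ad mulr_suml mulr_sumr sumrB. Qed.

Lemma ad_sumr n a (F : 'I_n -> A) : ad a (\sum_i F i) = \sum_i ad a (F i).
Proof. by rewrite /ad mulr_suml mulr_sumr sumrB. Qed.

Lemma adMl a b x : ad (a * b) x = a * ad b x + ad a x * b.
Proof. by rewrite /ad mulrBr mulrBl !mulrA addrA subrK. Qed.

Lemma ad_eq0 a b : ad a b = 0 <-> a * b = b * a.
Proof. by split=> [/subr0_eq | e]; rewrite // /ad e subrr. Qed.

Lemma adC_ad a b x : a * b = b * a -> ad a (ad b x) = ad b (ad a x).
Proof.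
move=> ab; rewrite /ad !mulrBr !mulrBl !opprB !mulrA ab -!mulrA ab.
rewrite -!addrA; congr (_ + _); rewrite addrCA [RHS]addrCA; congr (_ + _).
exact: addrC.
Qed.

(** The order in which u is bracketed with functions is irrelevant. *)
Lemma ad_adC x a b : a * b = b * a -> ad (ad x a) b = ad (ad x b) a.
Proof.
move=> ab; have ad_opp y z : ad y z = - ad z y by rewrite /ad opprB.
by rewrite ![ad x _]ad_opp -!scaleN1r !adZl ![ad (ad _ _) _]ad_opp adC_ad.
Qed.

Lemma iter_ad_comm a b x n :
  a * b = b * a -> iter n (ad a) (ad b x) = ad b (iter n (ad a) x).
Proof. by move=> ab; elim: n => //= n ->; exact: adC_ad. Qed.

Lemma horner_algE a p : horner_alg a p = \sum_(i < size p) p`_i *: a ^+ i.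
Proof.
rewrite -{1}[p]coefK poly_def linear_sum; apply: eq_bigr => i _.
by rewrite linearZ /= rmorphXn /= horner_algX mulr_algl.
Qed.

Lemma horner_alg_comm a p : a * horner_alg a p = horner_alg a p * a.
Proof.
rewrite horner_algE mulr_sumr mulr_suml; apply: eq_bigr => i _.
by rewrite -scalerAr -scalerAl -exprS -exprSr.
Qed.

Lemma ad_horner_comm a p x : ad a x = 0 -> ad (horner_alg a p) x = 0.
Proof.
move=> /ad_eq0 ax; apply/ad_eq0.
rewrite horner_algE mulr_sumr mulr_suml; apply: eq_bigr => i _.
rewrite -scalerAr -scalerAl; congr (_ *: _).
by apply/esym; apply: commrX.
Qed.

(** The chain rule [f(a), x] = f'(a) [a, x]; it needs [a, x] to commute with a,
    since otherwise higher powers of ad a enter. *)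
Lemma ad_horner_deriv a x p : ad a (ad a x) = 0 ->
  ad (horner_alg a p) x = horner_alg a p^`() * ad a x.
Proof.
move=> yC; elim/poly_ind: p => [|p c IHp].
  by rewrite deriv0 !raddf0 /ad mul0r mulr0 subrr mul0r.
rewrite derivMXaddC !rmorphD !rmorphM /= !horner_algX horner_algC.
rewrite adDl adMl IHp adZl [X in _ *: X]/ad mul1r mulr1 subrr scaler0 addr0.
rewrite mulrDl; congr (_ + _).
by rewrite -!mulrA; congr (_ * _); apply/esym/ad_eq0.
Qed.

(** If p(a) commutes with x, then p'(a) [a, x] = 0, so p'(a) = 0, and a fortiori
    p'(a) commutes with x: the degree can be lowered until p' is constant. *)
Lemma ad_horner_nilpotent_size (charK : [pchar K] =i pred0) a x p :
    ad a (ad a x) = 0 ->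
    (forall q, horner_alg a q * ad a x = 0 -> horner_alg a q = 0) ->
  ad (horner_alg a p) x = 0 -> (size p <= 1)%N.
Proof.
move=> yC regy; have [k] := ubnP (size p).
elim: k p => // k IHk p; rewrite ltnS => szp; have [->|p0] := eqVneq p 0.
  by rewrite size_poly0.
rewrite ad_horner_deriv // => /regy dp0.
have /size1_polyC dpE : (size p^`() <= 1)%N.
  apply: IHk; first exact: leq_trans (lt_size_deriv p0) szp.
  by rewrite dp0 /ad mul0r mulr0 subrr.
have c0 : (p^`())`_0 = 0.
  move: dp0; rewrite dpE horner_algC coefC eqxx => /eqP.
  by rewrite scaler_eq0 oner_eq0 orbF => /eqP.
have {c0} dp0' : p^`() = 0 by rewrite dpE c0.
apply/leq_sizeP => -[//|j] _; have := congr1 (fun q : {poly K} => q`_j) dp0'.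
rewrite coef_deriv coef0 -mulr_natr => /eqP; rewrite mulf_eq0.
by have /pcharf0P-> := charK; rewrite orbF => /eqP.
Qed.

Lemma center_adC a : center a <-> adC a = setT.
Proof.
split=> [Ca | CT b]; first by rewrite -subTset => b _; apply/ad_eq0/Ca.
by apply/ad_eq0; have : adC a b by rewrite CT.
Qed.

Lemma adD_eq_adC a :
    (forall (l : K) x, l != 0 -> ad a x = l *: x -> x = 0) ->
  adD a = adC a.
Proof.
move=> noeig; apply/seteqP; split=> [b [n [l [v [ev ->]]]] | b Cb].
  rewrite /adC /= ad_sumr big1 // => i _; rewrite ev.
  have [->|li0] := eqVneq (l i) 0; first exact: scale0r.
  by rewrite (noeig _ _ li0 (ev i)) scaler0.
exists 1%N, (fun=> 0), (fun=> b); split=> [i|]; last by rewrite big_ord1.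
by rewrite scale0r.
Qed.

(** An eigenvector killed by a power of ad a has eigenvalue 0. *)
Lemma adN_full_adD a : adN a = setT -> adD a = adC a.
Proof.
move=> NT; apply: adD_eq_adC => l x l0 ax.
have [i _ /= ix] : adN a x by rewrite NT.
have iterE k : iter k (ad a) x = l ^+ k *: x.
  by elim: k => [|k /= ->]; rewrite ?scale1r // adZr ax scalerA exprSr.
have := iterE i.+1; rewrite /= ix => /esym/eqP.
by rewrite scaler_eq0 expf_eq0 (negPf l0) /= => /eqP.
Qed.

Lemma adN_eq_of_adC a b : a * b = b * a ->
  (forall x, ad b x = 0 <-> ad a x = 0) -> adN b = adN a.
Proof.
move=> ab eqC.
have iterE k x : iter k (ad b) x = 0 <-> iter k (ad a) x = 0.
  elim: k x => // k IHk x; rewrite [iter k.+1 (ad a) x]iterSr -IHk.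
  by rewrite iter_ad_comm //= eqC.
by apply/seteqP; split=> x [i _ /= h]; exists i => //; apply/(iterE i.+1).
Qed.

End InnerDerivations.

(** * Principal symbols of differential operators *)

Section Symbols.
Variables (K : fieldType) (charK : [pchar K] =i pred0) (O : idomAlgType K).
Implicit Types (u v w a x : endo O) (r s t : O) (c : K).

Lemma natK0 n : n.+1%:R != 0 :> K.
Proof. by have /pcharf0P-> := charK. Qed.

Lemma mulopD r s : mulop (r + s) = mulop r + mulop s :> endo O.
Proof. by apply: endoP => z; exact: mulrDl. Qed.

Lemma mulopZ c r : mulop (c *: r) = c *: mulop r :> endo O.
Proof. by apply: endoP => z; exact/esym/scalerAl. Qed.

Lemma mulopC r s : mulop r * mulop s = mulop s * mulop r :> endo O.
Proof. by apply: endoP => z; exact: mulrCA. Qed.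

Lemma diffop_ord0P u : diffop_ord 0 u -> u = mulop (u 1).
Proof.
move=> D0; apply: endoP => z.
have /subr0_eq/(congr1 (fun w : endo O => w 1)) := D0 z.
by rewrite /= => e; rewrite mulrC -{1}[z]mulr1.
Qed.

(** The principal symbol. The factorial is distributed over the recursion; with
    it, symbols multiply without binomial coefficients. For u of order at most n
    the iterated commutator has order 0, so its value at 1 determines it. *)
Fixpoint sym n u r : O :=
  if n is m.+1 then (n%:R^-1 : K) *: sym m (ad u (mulop r)) r else u 1.

Lemma sym_linear n c u v r : sym n (c *: u + v) r = c *: sym n u r + sym n v r.
Proof.
elim: n u v => //= n IHn u v.
by rewrite adDl adZl IHn scalerDr !scalerA mulrC.
Qed.

Lemma sym0 n r : sym n 0 r = 0.
Proof.
by have := sym_linear n (-1) 0 0 r; rewrite scaleN1r addNr scaleN1r addNr.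
Qed.

Lemma symD n u v r : sym n (u + v) r = sym n u r + sym n v r.
Proof. by rewrite -[u]scale1r sym_linear !scale1r. Qed.

Lemma symZ n c u r : sym n (c *: u) r = c *: sym n u r.
Proof. by rewrite -[c *: u]addr0 sym_linear sym0 addr0. Qed.

Lemma sym_sum n k (F : 'I_k -> endo O) r :
  sym n (\sum_i F i) r = \sum_i sym n (F i) r.
Proof.
by elim/big_rec2: _ => [|i y z _ <-]; [exact: sym0 | exact: symD].
Qed.

Lemma sym_ad n u r : sym n (ad u (mulop r)) r = sym n.+1 u r *+ n.+1.
Proof. by rewrite /= -scaler_nat scalerA divff ?natK0 // scale1r. Qed.

Lemma sym_lt k n u r : diffop_ord k u -> (k < n)%N -> sym n u r = 0.
Proof.
elim: k n u => [|k IHk] [|n] u Du //= ltkn.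
  by rewrite [ad _ _]Du sym0 scaler0.
by rewrite IHk ?scaler0 //; exact: Du.
Qed.

(** By induction on i + j: by Leibniz, (i + j) times the left-hand side is the
    sum of the symbols of u [v, r] and [u, r] v, which by induction are j and i
    times the right-hand side. *)
Lemma symM i j u v r : diffop_ord i u -> diffop_ord j v ->
  sym (i + j) (u * v) r = sym i u r * sym j v r.
Proof.
have [n] := ubnP (i + j)%N; elim: n i j u v => // n IHn i j u v lijn Du Dv.
case ijE: (i + j)%N lijn => [|k]; rewrite ltnS.
  move/eqP: ijE; rewrite addn_eq0 => /andP[/eqP i0 /eqP j0] _.
  move: Du; rewrite {}i0 => /diffop_ord0P->; rewrite j0 /=.
  by rewrite mulr1.
move=> lkn /=; rewrite adMl symD.
have -> : sym k (u * ad v (mulop r)) r = sym i u r * sym j v r *+ j.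
  case: j Dv ijE => [|j] Dv ijE; first by rewrite [ad _ _]Dv mulr0 sym0.
  have kE : k = (i + j)%N by apply: succn_inj; rewrite -ijE addnS.
  rewrite kE IHn -?kE //; last exact: Dv.
  by rewrite sym_ad mulrnAr.
have -> : sym k (ad u (mulop r) * v) r = sym i u r * sym j v r *+ i.
  case: i Du ijE => [|i] Du ijE; first by rewrite [ad _ _]Du mul0r sym0.
  have kE : k = (i + j)%N by apply: succn_inj; rewrite -ijE addSn.
  rewrite kE IHn -?kE //; last exact: Du.
  by rewrite sym_ad mulrnAl.
rewrite -mulrnDr addnC ijE -scaler_nat scalerA mulVf ?natK0 //.
exact: scale1r.
Qed.

Lemma symX i m u r : diffop_ord m u ->
  diffop_ord (i * m) (u ^+ i) /\ sym (i * m) (u ^+ i) r = sym m u r ^+ i.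
Proof.
move=> Du; elim: i => [|i [Di symi]].
  by split=> // s; rewrite mul1r mulr1 subrr.
rewrite mulSn !exprS; split; first exact: diffop_ordM.
by rewrite symM // symi.
Qed.

(** Restricted to the line r + c s, the symbol is a polynomial in c. Its linear
    coefficient, the derivative in the direction s, is the symbol of [u, s]:
    this is the polarization identity. *)
Lemma sym_line n u r s : exists p : {poly O},
  (forall c, p.[c%:A] = sym n u (r + c *: s)) /\
  p`_1 = if n is m.+1 then sym m (ad u (mulop s)) r else 0.
Proof.
elim: n u => [|n IHn] u.
  by exists (u 1)%:P; split=> [c|]; rewrite ?hornerC ?coefC.
have [p1 [p1E p11]] := IHn (ad u (mulop r)).
have [p2 [p2E _]] := IHn (ad u (mulop s)).
exists ((n.+1%:R^-1 : K)%:A *: (p1 + 'X * p2)); split=> [c|].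
  rewrite hornerZ hornerD hornerM hornerX p1E p2E !mulr_algl -symZ -symD /=.
  by rewrite mulopD mulopZ adDr adZr.
have p20 : p2`_0 = sym n (ad u (mulop s)) r.
  by rewrite -horner_coef0 -(scale0r (1 : O)) p2E scale0r addr0.
rewrite coefZ coefD coefXM /= p11 p20 {p1 p1E p11 p2 p2E p20}.
have -> : (if n is m.+1 then sym m (ad (ad u (mulop r)) (mulop s)) r else 0) =
          sym n (ad u (mulop s)) r *+ n.
  by case: n {IHn} => // m; rewrite ad_adC ?sym_ad //; exact: mulopC.
by rewrite -mulrSr mulr_algl -scaler_nat scalerA mulVf ?natK0 // scale1r.
Qed.

(** The scalars c contain the infinitely many natural numbers. *)
Lemma poly_line_eq0 (p : {poly O}) : (forall c, p.[c%:A] = 0) -> p = 0.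
Proof.
move=> p0; apply/eqP/negPn/negP => /max_poly_roots.
move=> /(_ [seq (k%:R : K)%:A | k <- iota 0 (size p)]).
rewrite size_map size_iota ltnn => h; suff: false by []; apply: h.
  by apply/allP => _ /mapP[k _ ->]; apply/eqP/p0.
rewrite map_inj_uniq ?iota_uniq // => i j /(fmorph_inj (in_alg O)).
wlog lij : i j / (i <= j)%N => [wl|].
  by case/orP: (leq_total i j) => l e; [exact: wl | exact/esym/wl].
move/esym/eqP; rewrite -subr_eq0 -natrB //; have /pcharf0P-> := charK.
by rewrite subn_eq0 => lji; apply/eqP; rewrite eqn_leq lij.
Qed.

(** If the symbol of u vanishes, so does its derivative in each direction s,
    which is the symbol of [u, s]; by induction on n, [u, s] has order less
    than n for all s. *)
Lemma diffop_ord_pred n u :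
  diffop_ord n.+1 u -> (forall r, sym n.+1 u r = 0) -> diffop_ord n u.
Proof.
have sym_adu w k s r : (forall t, sym k.+1 w t = 0) ->
    sym k (ad w (mulop s)) r = 0.
  move=> symw; have [p [pE /= <-]] := sym_line k.+1 w r s.
  by rewrite (poly_line_eq0 (p := p)) ?coef0 // => c; rewrite pE.
elim: n u => [|n IHn] u Du symu s.
  rewrite [LHS](diffop_ord0P (Du s)).
  have /= -> := sym_adu u 0%N s 0 symu.
  by apply: endoP => z; exact: mul0r.
by apply: IHn (Du s) _ => r; exact: sym_adu.
Qed.

(** A nonzero operator has an exact order n; this is expressed by a point r
    where the symbol of degree n does not vanish, which also makes sense for
    n = 0. *)
Lemma order_exists k u : diffop_ord k u -> u <> 0 ->
  exists n, [/\ (n <= k)%N, diffop_ord n u & exists r, sym n u r != 0].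
Proof.
move=> + u0; elim: k => [|k IHk] Du.
  exists 0%N; split=> //; exists 0; apply/eqP => /= u10; apply: u0.
  by rewrite (diffop_ord0P Du) u10; apply: endoP => z; exact: mul0r.
have [[r ur]|nor] := pselect (exists r, sym k.+1 u r != 0).
  by exists k.+1; split=> //; exists r.
have [|n [lnk Dn ex]] := IHk; last by exists n; split=> //; exact: leqW.
apply: diffop_ord_pred => // r; apply/eqP/negPn/negP => ur.
by apply: nor; exists r.
Qed.

(** Two nonzero symbols are simultaneously nonzero at some point of the line
    through r and s, because two nonzero polynomials are so at some scalar. With
    [symM] this shows that the graded ring is a domain. *)
Lemma sym_common m n u v r s : sym m u r != 0 -> sym n v s != 0 ->
  exists t, sym m u t != 0 /\ sym n v t != 0.
Proof.
move=> ur vs.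
have [p [pE _]] := sym_line m u r (s - r).
have [q [qE _]] := sym_line n v r (s - r).
have pq0 : p * q != 0.
  rewrite mulf_neq0 //.
    apply: contraNneq ur => p0.
    by have := pE 0; rewrite p0 horner0 scale0r addr0 => <-.
  apply: contraNneq vs => q0.
  by have := qE 1; rewrite q0 horner0 scale1r addrC subrK => <-.
have [[c /negP]|noc] := pselect (exists c, ~ (p * q).[c%:A] == 0).
  rewrite hornerM mulf_eq0 negb_or pE qE => /andP[? ?].
  by exists (r + c *: (s - r)).
case/eqP: pq0; apply: poly_line_eq0 => c; apply/eqP/negPn/negP => h.
by apply: noc; exists c; exact/negP.
Qed.

(** All i + 1 summands a^j [a, x] a^(i-j) of [a^(i+1), x] have the same symbol,
    as values of symbols commute. *)
Lemma sym_adX m n a x r i : diffop_ord m a -> diffop_ord n (ad a x) ->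
  diffop_ord (i * m + n) (ad (a ^+ i.+1) x) /\
  sym (i * m + n) (ad (a ^+ i.+1) x) r =
    sym m a r ^+ i * sym n (ad a x) r *+ i.+1.
Proof.
move=> Da Dy; elim: i => [|i [Di symi]]; first by rewrite expr1 mul1r.
have [DX symX_] := symX i.+1 r Da.
rewrite exprS adMl; split.
  apply: diffop_ordD; first by rewrite mulSn -addnA; exact: diffop_ordM.
  by rewrite addnC; exact: diffop_ordM.
rewrite symD [X in _ + X](_ : _ = sym n (ad a x) r * sym m a r ^+ i.+1).
  rewrite mulSn -addnA symM // symi [in RHS]mulrSr mulrnAr mulrA -exprS.
  by congr (_ + _); exact: mulrC.
by rewrite addnC symM // symX_.
Qed.

(** With order of a positive, only the top power of a contributes in this
    degree. *)
Lemma sym_ad_horner (f : {poly K}) e m n a x r : size f = e.+2 ->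
    diffop_ord m.+1 a -> diffop_ord n (ad a x) ->
  sym (e * m.+1 + n) (ad (horner_alg a f) x) r =
    lead_coef f *: (sym m.+1 a r ^+ e * sym n (ad a x) r *+ e.+1).
Proof.
move=> szf Da Dy; rewrite horner_algE szf ad_suml sym_sum big_ord_recr /=.
rewrite big1 ?add0r => [|[[|i] lti] _ /=].
- have [_ symE] := sym_adX r e Da Dy.
  by rewrite adZl symZ symE lead_coefE szf.
- by rewrite adZl symZ expr0 /ad mul1r mulr1 subrr sym0 scaler0.
- have [Di _] := sym_adX r i Da Dy.
  by rewrite adZl symZ (sym_lt r Di) ?scaler0 // ltn_add2r ltn_pmul2r.
Qed.

(** The order of [f(a), x] is at least (deg f - 1) ord a + ord [a, x]: where the
    symbols of a and [a, x] are both nonzero, [sym_ad_horner] gives a nonzero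
    value. *)
Lemma ad_horner_order (f : {poly K}) e m n a x r s k : size f = e.+2 ->
    diffop_ord m.+1 a -> sym m.+1 a r != 0 ->
    diffop_ord n (ad a x) -> sym n (ad a x) s != 0 ->
  diffop_ord k (ad (horner_alg a f) x) -> (e * m.+1 + n <= k)%N.
Proof.
move=> szf Da ar Dy ys Dk; rewrite leqNgt; apply/negP => ltk.
have [t [at0 yt]] := sym_common ar ys.
have := sym_ad_horner t szf Da Dy; rewrite (sym_lt t Dk ltk) => /esym/eqP.
rewrite -scaler_nat !scaler_eq0 lead_coef_eq0 -size_poly_eq0 szf /=.
by rewrite (negPf (natK0 e)) mulf_eq0 expf_eq0 (negPf at0) (negPf yt) andbF.
Qed.

End Symbols.

(** * Polynomials in a differential operator *)

Section PolynomialsInOperators.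
Variables (K : fieldType) (charK : [pchar K] =i pred0) (O : idomAlgType K).
Implicit Types (a x : diffop O) (f : {poly K}).

Lemma val_horner_alg a f : val (horner_alg a f) = horner_alg (val a) f.
Proof.
rewrite !horner_algE raddf_sum; apply: eq_bigr => i _.
rewrite /=; congr (_ *: _).
by elim: (i : nat) => // k IHk; rewrite !exprS -IHk.
Qed.

Lemma val_ad a x : val (ad a x) = ad (val a) (val x).
Proof. by []. Qed.

Lemma diffop_order_bound a : exists k, diffop_ord k (val a).
Proof. by have /asboolP[k _ Dk] := diffop_valP a; exists k. Qed.

Lemma val_neq0 a : a <> 0 -> val a <> 0.
Proof. by move=> a0 va; apply: a0; apply: val_inj; rewrite va. Qed.

Section PositiveOrder.
Variables (f : {poly K}) (e m : nat) (a : diffop O) (r : O).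
Hypotheses (szf : size f = e.+3) (Da : diffop_ord m.+1 (val a)).
Hypothesis (ar : sym m.+1 (val a) r != 0).

(** As (deg f - 1) ord a > 0, taking the commutator with f(a) instead of a
    strictly raises the order. *)
Lemma ad_horner_grows k x : ad a x <> 0 ->
    diffop_ord k (val (ad (horner_alg a f) x)) ->
  exists2 n, (n < k)%N & diffop_ord n (val (ad a x)).
Proof.
move=> y0 Dk; have [j Dj] := diffop_order_bound (ad a x).
have [n [_ Dn [s ys]]] := order_exists charK Dj (val_neq0 y0).
exists n => //; rewrite val_ad in Dn ys.
have Dk' : diffop_ord k (ad (horner_alg (val a) f) (val x)).
  by move: Dk; rewrite val_ad val_horner_alg.
apply: leq_trans (ad_horner_order charK szf Da ar Dn ys Dk').
by rewrite -[leqLHS]addn1 addnC leq_add2r muln_gt0.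
Qed.

Lemma horner_adC x : ad (horner_alg a f) x = 0 <-> ad a x = 0.
Proof.
split=> [bx|]; last exact: ad_horner_comm.
apply: contrapT => /(@ad_horner_grows 0)[|//].
by rewrite bx; exact: diffop_ord0.
Qed.

(** Infinite descent: if x is an eigenvector for l, so is [a, x], and by
    [ad_horner_grows] it has smaller order than [f(a), x] = l x. *)
Lemma horner_no_eigenvector (l : K) x :
  l != 0 -> ad (horner_alg a f) x = l *: x -> x = 0.
Proof.
move=> l0; have [k] := diffop_order_bound x.
elim/ltn_ind: k x => k IHk x Dx bx.
have y0 : ad a x = 0.
  apply: contrapT => y0.
  have [|n ltnk Dn] := ad_horner_grows (k := k) y0.
    rewrite bx -[l *: x]addr0; apply: diffop_ord_linear => //.
    exact: diffop_ord0.
  apply/y0/(IHk n ltnk) => //.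
  by rewrite adC_ad ?bx ?adZr // horner_alg_comm.
move/eqP: bx; rewrite ad_horner_comm // eq_sym scaler_eq0 (negPf l0) /=.
by move/eqP.
Qed.

Lemma horner_adC_eq : adC (horner_alg a f) = adC a.
Proof. by apply/seteqP; split=> x /horner_adC. Qed.

Lemma horner_adN_eq : adN (horner_alg a f) = adN a.
Proof.
by apply: adN_eq_of_adC; [exact: horner_alg_comm | exact: horner_adC].
Qed.

Lemma horner_adD_eq : adD (horner_alg a f) = adC (horner_alg a f).
Proof. exact/adD_eq_adC/horner_no_eigenvector. Qed.

End PositiveOrder.

(** The commutator with a function lowers the order. *)
Lemma order0_adN a : diffop_ord 0 (val a) -> adN a = setT.
Proof.
move=> /diffop_ord0P aE; rewrite -subTset => x _.
have [k Dk] := diffop_order_bound x.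
exists k => //=; elim: k x Dk => [|k IHk] x Dx.
  apply/ad_eq0/val_inj; have /subr0_eq := Dx (val a 1).
  by rewrite -aE => e; exact/esym.
rewrite -iterS iterSr; apply: IHk.
have -> : val (ad a x) = (-1) *: ad (val x) (val a) + 0.
  by rewrite scaleN1r addr0 opprB.
apply: diffop_ord_linear; last exact: diffop_ord0.
by rewrite [X in ad _ X]aE; exact: Dx.
Qed.

Lemma horner_order0 a f :
  diffop_ord 0 (val a) -> diffop_ord 0 (val (horner_alg a f)).
Proof.
move=> Da s; apply/ad_eq0; rewrite val_horner_alg.
exact/(@ad_eq0 K)/ad_horner_comm/Da.
Qed.

Lemma order0_mul_eq0 a x : diffop_ord 0 (val a) -> x <> 0 -> a * x = 0 -> a = 0.
Proof.
move=> /diffop_ord0P aE x0 ax0.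
have a10 : val a 1 = 0.
  apply: contrapT => /eqP a1; apply: x0; apply: val_inj; apply: endoP => z.
  have := congr1 (fun w : diffop O => val w z) ax0.
  rewrite /= [diffop_val a]aE /= => /eqP.
  by rewrite mulf_eq0 (negPf a1) /= => /eqP.
by apply: val_inj; rewrite aE a10; apply: endoP => z; exact: mul0r.
Qed.

Lemma horner_order0_not_center a f : (1 < size f)%N ->
  diffop_ord 0 (val a) -> ~ center a -> ~ center (horner_alg a f).
Proof.
move=> szf Da nCa Cb.
have [x ax0 aax0] : exists2 x, ad a x <> 0 & ad a (ad a x) = 0.
  apply: contrapT => nox; apply/nCa/center_adC; rewrite -subTset => x _.
  have [i _ /=] : adN a x by rewrite order0_adN.
  elim: i => // i IHi /= ii; apply: IHi; apply: contrapT => aix.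
  by apply: nox; exists (iter i (ad a) x).
move: szf; rewrite ltnNge => /negP; apply.
apply: (ad_horner_nilpotent_size charK aax0).
  by move=> q; apply: order0_mul_eq0 => //; exact: horner_order0.
exact/ad_eq0/Cb.
Qed.

End PolynomialsInOperators.

Theorem corollary7p4 (K : closedFieldType) (charK : [pchar K] =i pred0)
    (O : idomAlgType K) (fgO : finitely_generated_alg O)
    (regO : regular_ring O) (dimO : krull_dim O 1)
    (f : {poly K}) (degf : (1 < (size f).-1)%N) :
  (forall i : nat, i \in [:: 1; 2; 5]%N ->
     forall a : diffop O, Delta i a -> Delta i (horner_alg a f))
  /\
  (forall i : nat, i \in [:: 3; 4]%N ->
     forall a : diffop O, Delta i a -> Delta 5 (horner_alg a f)).
Proof.
have [e szf] : exists e, size f = e.+3.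
  by case: (size f) degf => [|[|[|e]]] // _; exists e.
(* The left alternative is order 0, the right one positive order. *)
have orderP (a : diffop O) : ~ center a ->
    (adN a = setT /\ [/\ ~ center (horner_alg a f),
      adN (horner_alg a f) = setT &
      adD (horner_alg a f) = adC (horner_alg a f)]) \/
    [/\ ~ center (horner_alg a f), adC (horner_alg a f) = adC a,
      adN (horner_alg a f) = adN a &
      adD (horner_alg a f) = adC (horner_alg a f)].
  move=> nCa; have a0 : a <> 0.
    by move=> a0; apply: nCa => b; rewrite a0 mul0r mulr0.
  have [k Dk] := diffop_order_bound a.
  have [[|m] [_ Da [r ar]]] := order_exists charK Dk (val_neq0 a0).
    left; split; first exact: order0_adN.
    have NT := order0_adN (horner_order0 f Da).
    split=> //; last exact: adN_full_adD.
    by apply: horner_order0_not_center => //; rewrite szf.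
  right; have CE := horner_adC_eq charK szf Da ar.
  split=> //; first by rewrite center_adC CE -center_adC.
    exact: (horner_adN_eq charK szf Da ar).
  exact: (horner_adD_eq charK szf Da ar).
have nNT (a : diffop O) : ~ center a -> adN a = adC a -> adN a <> setT.
  by move=> nCa NC; rewrite NC => /center_adC.
split=> i; rewrite !inE.
  case/or3P=> /eqP-> a [nCa].
  - by case=> NT DC; case: (orderP a nCa) => [[_ []]|[? CE NE DE]];
      do !split=> //; rewrite NE.
  - by case=> CN NT DC; case: (orderP a nCa) => [[/NT]|[? CE NE DE]] //;
      do !split=> //; rewrite ?CE ?NE.
  - case=> ND DC; have NC := etrans ND DC.
    case: (orderP a nCa) => [[/(nNT _ nCa NC)]|[? CE NE DE]] //.
    by do !split=> //; rewrite NE DE CE.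
case/orP=> /eqP-> a [nCa].
- case=> NC _; case: (orderP a nCa) => [[/(nNT _ nCa NC)]|[? CE NE DE]] //.
  by do !split=> //; rewrite NE DE CE.
- case=> NC _ _ _; case: (orderP a nCa) => [[/(nNT _ nCa NC)]|[? CE NE DE]] //.
  by do !split=> //; rewrite NE DE CE.
Qed.
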